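(* For every positive integer $n$, $$\sum_{k=0}^{n}\binom{n}{k}B^{*}_{n-k}(y,t)B^{*}_k(y,t)=\frac{1}{2(9y^2-t)}\left(2^nC_n(y,t)-(6y)^n\right),$$ $$\sum_{k=0}^{n}\binom{n}{k}2C_{n-k}(y,t)C_k(y,t)=2^nC_n(y,t)+(6y)^n,$$ $$\sum_{k=0}^{n}\binom{n}{k}B^{*}_{n-k}(y,t)C_k(y,t)=2^{n-1}B^{*}_n(y,t).$$
   Context: Here $y,t$ are commuting variables (indeterminates). The bivariate balancing polynomials are defined by $B^{*}_0(y,t)=0$, $B^{*}_1(y,t)=1$, $B^{*}_n(y,t)=6yB^{*}_{n-1}(y,t)-tB^{*}_{n-2}(y,t)$ for $n\ge 2$; the bivariate Lucas-balancing polynomials by $C_0(y,t)=1$, $C_1(y,t)=3y$, $C_n(y,t)=6yC_{n-1}(y,t)-tC_{n-2}(y,t)$ for $n\ge 2$. *)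

(* Defs.v *)
From HB Require Import structures.
From mathcomp Require Import all_boot all_order all_algebra.
From mathcomp Require Import mpoly.

Set Implicit Arguments.
Unset Strict Implicit.
Unset Printing Implicit Defensive.

Import GRing.Theory.
Local Open Scope ring_scope.

(* The recurrences have integer coefficients, so the bivariate
   polynomials live in Z[y, t]; the fraction field used for the division by
   2 (9 y^2 - t) is then Q(y, t). *)
Definition Zyt : idomainType := {mpoly int[2]}.
Definition y : Zyt := 'X_ord0.
Definition t : Zyt := 'X_ord_max.

Fixpoint balancing (n : nat) : Zyt :=
  match n with
  | 0 => 0
  | 1 => 1
  | (m.+1 as p).+1 => 6 * y * balancing p - t * balancing m
  end.

Fixpoint lucas_balancing (n : nat) : Zyt :=
  match n with
  | 0 => 1
  | 1 => 3 * y
  | (m.+1 as p).+1 => 6 * y * lucas_balancing p - t * lucas_balancing m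
  end.

Notation "x %:F" := (@FracField.tofrac _ x) : ring_scope.

(* Main.v *)
Require Import Defs.
From HB Require Import structures.
From mathcomp Require Import all_boot all_order all_algebra.
From mathcomp Require Import mpoly.
From mathcomp Require Import ring.

Set Implicit Arguments.
Unset Strict Implicit.
Unset Printing Implicit Defensive.

Import GRing.Theory.
Local Open Scope ring_scope.

(** Put d = 9 y^2 - t. The polynomials C_n and B_n are the two components of
    (3 y + sqrt d)^n = C_n + B_n sqrt d, so the pair (C, B) satisfies a
    first-order linear recurrence. The shift is a derivation for binomial
    convolution, so the convolutions CC, BB, BC and CB satisfy a first-order
    linear recurrence too, whose solution comes from
    (2 (3 y + sqrt d))^n and ((3 y + sqrt d) + (3 y - sqrt d))^n = (6 y)^n. *)

Definition binomial_convolution (R : pzSemiRingType) (a b : nat -> R) n : R :=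
  \sum_(0 <= k < n.+1) 'C(n, k)%:R * a (n - k)%N * b k.

Section BinomialConvolution.
Variable R : comNzRingType.
Implicit Types a b c : nat -> R.

(** Pascal's rule splits the sum in two. For exponential generating functions, where the index shift
    is differentiation, this is the product rule. *)
Lemma binomial_convolutionS a b n :
  binomial_convolution a b n.+1 =
  binomial_convolution (fun k => a k.+1) b n
  + binomial_convolution a (fun k => b k.+1) n.
Proof.
rewrite /binomial_convolution big_nat_recl //.
under eq_bigr => k _ do rewrite binS natrD !mulrDl subSS.
rewrite big_split addrA /=; congr (_ + _).
(* The last term carries ['C(n, n.+1)], which is 0; the separated term [k = 0] takes its place. *)
rewrite big_nat_recr //= (bin_small (ltnSn n)) !mul0r addr0.
rewrite [RHS]big_nat_recl // !bin0 !subn0.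
congr (_ + _); rewrite !big_nat; apply: eq_bigr => k /andP[_ ltkn].
by rewrite -subSn.
Qed.

Lemma eq_binomial_convolution a a' b b' :
  a =1 a' -> b =1 b' ->
  binomial_convolution a b =1 binomial_convolution a' b'.
Proof. by move=> eqa eqb n; apply: eq_bigr => k _; rewrite eqa eqb. Qed.

Lemma binomial_convolution_linearl u v a b c n :
  binomial_convolution (fun k => u * a k + v * b k) c n =
  u * binomial_convolution a c n + v * binomial_convolution b c n.
Proof. by rewrite !mulr_sumr -big_split; apply: eq_bigr => k _ /=; ring. Qed.

Lemma binomial_convolution_linearr u v a b c n :
  binomial_convolution c (fun k => u * a k + v * b k) n =
  u * binomial_convolution c a n + v * binomial_convolution c b n.
Proof. by rewrite !mulr_sumr -big_split; apply: eq_bigr => k _ /=; ring. Qed.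

(** The factors 2 and [2 * d] keep the closed forms free of division. The symmetry in the last
    conjunct is carried through the induction to merge the two mixed convolutions. The coefficient
    in [1 * C n] gives the shape that the linearity lemmas expect. *)
Lemma binomial_convolution_quadratic (x d : R) (B C : nat -> R) :
    B 0%N = 0 -> C 0%N = 1 ->
    (forall n, B n.+1 = x * B n + 1 * C n) ->
    (forall n, C n.+1 = x * C n + d * B n) ->
  forall n,
  [/\ 2 * d * binomial_convolution B B n = 2 ^+ n * C n - (2 * x) ^+ n,
      2 * binomial_convolution C C n = 2 ^+ n * C n + (2 * x) ^+ n,
      2 * binomial_convolution B C n = 2 ^+ n * B n
    & binomial_convolution B C n = binomial_convolution C B n].
Proof.
move=> B0 C0 BS CS; elim=> [|n [IHBB IHCC IHBC BC_CB]].
  by rewrite /binomial_convolution !big_nat1 bin0 B0 C0; split; ring.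
have convS a b a' b' : (forall k, a k.+1 = a' k) -> (forall k, b k.+1 = b' k) ->
    binomial_convolution a b n.+1 =
    binomial_convolution a' b n + binomial_convolution a b' n.
  by move=> eqa eqb; rewrite binomial_convolutionS;
     congr (_ + _); apply: eq_binomial_convolution.
rewrite (convS _ _ _ _ BS BS) (convS _ _ _ _ CS CS).
rewrite (convS _ _ _ _ BS CS) (convS _ _ _ _ CS BS).
rewrite !binomial_convolution_linearl !binomial_convolution_linearr -BC_CB.
rewrite BS CS !exprS; split.
- transitivity (2 * x * (2 * d * binomial_convolution B B n)
                + 2 * d * (2 * binomial_convolution B C n)); first by ring.
  by rewrite IHBB IHBC; ring.
- transitivity (2 * x * (2 * binomial_convolution C C n)
                + 2 * d * (2 * binomial_convolution B C n)); first by ring.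
  by rewrite IHCC IHBC; ring.
(* The powers of [2 * x] in the closed forms for CC and BB cancel in their sum. *)
- transitivity (2 * x * (2 * binomial_convolution B C n)
                + (2 * binomial_convolution C C n
                   + 2 * d * binomial_convolution B B n)); first by ring.
  by rewrite IHBB IHCC IHBC; ring.
- by ring.
Qed.

(** Both equations express multiplication by 3 y + sqrt d, a root of X^2 = 6 y X - t. They are
    proved together because each one at [n.+1] uses both at [n]. *)
Lemma quadratic_first_order (y t : R) (B C : nat -> R) :
    B 0%N = 0 -> B 1%N = 1 -> C 0%N = 1 -> C 1%N = 3 * y ->
    (forall n, B n.+2 = 6 * y * B n.+1 - t * B n) ->
    (forall n, C n.+2 = 6 * y * C n.+1 - t * C n) ->
  forall n, B n.+1 = 3 * y * B n + 1 * C n /\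
            C n.+1 = 3 * y * C n + (9 * y ^+ 2 - t) * B n.
Proof.
move=> B0 B1 C0 C1 BSS CSS; elim=> [|n [IHB IHC]].
  by rewrite B0 B1 C0 C1; split; ring.
by rewrite BSS CSS IHB IHC; split; ring.
Qed.

End BinomialConvolution.

Lemma two_neq0 : 2 != 0 :> Zyt.
Proof. by rewrite -mpolyC_nat mpolyC_eq0. Qed.

Lemma discriminant_neq0 : 9 * y ^+ 2 - t != 0.
Proof.
(* The coefficient of the monomial [t] is -1, since [y ^+ 2] does not contribute to it. *)
apply/eqP => /(congr1 (mcoeff U_(ord_max))).
apply/eqP; rewrite mcoeffB mcoeff0 -mpolyC_nat mcoeffCM mpolyXn !mcoeffX.
rewrite eqxx (_ : (_ == U_(ord_max))%MM = false) ?mulr0 //.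
by apply/negbTE/eqP => /mnmP/(_ ord0); rewrite mulmnE !mnm1E.
Qed.

Theorem corollary3 (n : nat) (hn : (0 < n)%N) :
  [/\ (\sum_(0 <= k < n.+1)
         'C(n, k)%:R * balancing (n - k) * balancing k)%:F
      = 1 / (2 * (9 * y ^+ 2 - t))%:F
        * (2 ^+ n * lucas_balancing n - (6 * y) ^+ n)%:F
        :> {fraction Zyt},
      \sum_(0 <= k < n.+1)
         'C(n, k)%:R * (2 * lucas_balancing (n - k) * lucas_balancing k)
      = 2 ^+ n * lucas_balancing n + (6 * y) ^+ n
    & \sum_(0 <= k < n.+1)
         'C(n, k)%:R * balancing (n - k) * lucas_balancing k
      = 2 ^+ n.-1 * balancing n].
Proof.
have first_order := @quadratic_first_order Zyt y t balancing lucas_balancing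
  erefl erefl erefl erefl (fun=> erefl) (fun=> erefl).
have [BB CC BC _] := @binomial_convolution_quadratic Zyt _ _ _ _ erefl erefl
  (fun k => (first_order k).1) (fun k => (first_order k).2) n.
rewrite (_ : 2 * (3 * y) = 6 * y) in BB CC; last by ring.
split.
- have d2_neq0 : (2 * (9 * y ^+ 2 - t))%:F != 0.
    by rewrite tofrac_eq0 mulf_neq0 ?two_neq0 ?discriminant_neq0.
  by rewrite -BB [in RHS](tofracM (2 * _)) mulrA div1r mulVf // mul1r.
- rewrite -CC mulr_sumr; apply: eq_bigr => k _.
  by rewrite !mulrA [2 * _]mulrC.
(* Positivity of [n] turns [2 * 2 ^+ n.-1] into [2 ^+ n], as in [BC]. *)
- by apply: (mulfI two_neq0); rewrite mulrA -exprS prednK.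
Qed.
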